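(* Let $c:\mathbb R^d\to\mathcal Y$ be a (measurable) deterministic classifier, let $\sigma>0$, and let $\mathfrak p: x\mapsto\mathcal N(x,\sigma^2 I_d)$ be the Gaussian pre-processing probabilistic mapping. Let $\mathrm m$ be the randomized classifier $\mathrm m: x\in\mathcal X\mapsto c\,\#\,\mathfrak p(x)$. Then, for every $\alpha_2>0$: \begin{itemize} \item for every $\beta\in[1,\infty)$, $\mathrm m$ is $\left(\alpha_2,\frac{(\alpha_2)^2\beta}{2\sigma^2}\right)$-robust with respect to the Renyi divergence $D_\beta$ against $\ell_2$ adversaries; \item $\mathrm m$ is $\left(\alpha_2,\,2\Phi\left(\frac{\alpha_2}{2\sigma}\right)-1\right)$-robust with respect to the total variation distance $D_{TV}$ against $\ell_2$ adversaries, \end{itemize} where $\Phi$ is the cumulative distribution function of the standard Gaussian distribution on $\mathbb R$.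
   Context: $\mathcal X\subset[-1,1]^d$ is the input space and $\mathcal Y=\{1,\dots,K\}$ the label set. $\mathcal P(\mathcal Y)$ is the set of probability measures on $\mathcal Y$. A randomized classifier is a map $\mathrm m:\mathcal X\to\mathcal P(\mathcal Y)$. $\psi\#\rho$ denotes the pushforward of the measure $\rho$ by the map $\psi$, i.e. $\mathrm m(x)$ is the law of $c(x+\xi)$ with $\xi\sim\mathcal N(0,\sigma^2I_d)$. For a metric/divergence $D$ on $\mathcal P(\mathcal Y)$, $\mathrm m$ is $(\alpha_2,\epsilon)$-robust w.r.t. $D$ against $\ell_2$ adversaries if for all $x,x'\in\mathcal X$ with $\|x-x'\|_2\le\alpha_2$ one has $D(\mathrm m(x),\mathrm m(x'))\le\epsilon$. Total variation distance: $D_{TV}(\rho,\rho')=\sup_{Z}|\rho(Z)-\rho'(Z)|$, supremum over measurable sets $Z$. Renyi divergence of order $\beta$: if $\rho,\rho'$ have densities $g,g'$ w.r.t. a common measure $\nu$, then for $\beta\in(1,\infty)$, $D_\beta(\rho,\rho')=\frac1{\beta-1}\log\int g'\,(g/g')^\beta\,d\nu$ (equal to $+\infty$ if $\rho$ is not absolutely continuous w.r.t. $\rho'$), and for $\beta=1$ it is the Kullback–Leibler divergence $\int g\log(g/g')\,d\nu$. *)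

(* Defs.v *)
From HB Require Import structures.
From mathcomp Require Import all_boot all_order all_algebra.
From mathcomp Require Import all_classical all_reals all_analysis.

Set Implicit Arguments.
Unset Strict Implicit.
Unset Printing Implicit Defensive.

Import Order.TTheory GRing.Theory Num.Theory.
Import numFieldNormedType.Exports.

Local Open Scope classical_set_scope.
Local Open Scope ring_scope.

(* The label set: a nonempty finite set with the discrete sigma-algebra.
   Labels are numbered from 0; a measurableType is required to be inhabited,
   hence 'I_n.+1. *)
HB.instance Definition _ (n : nat) := isPointed.Build 'I_n.+1 ord0.
HB.instance Definition _ (n : nat) :=
  @isMeasurable.Build default_measure_display 'I_n.+1
    discrete_measurable discrete_measurable0
    discrete_measurableC discrete_measurableU.

Section divergences.
Context d (T : measurableType d) (R : realType).

Definition tv_distance (rho rho' : probability T R) : \bar R :=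
  ereal_sup [set `|rho Z - rho' Z|%E | Z in d.-measurable].

Definition dominating (rho rho' : probability T R) : set T -> \bar R :=
  measure_add rho rho'.

HB.instance Definition _ (rho rho' : probability T R) :=
  Measure.on (dominating rho rho').

Let dominating_fin (rho rho' : probability T R) :
  fin_num_fun (dominating rho rho').
Proof.
by move=> A mA; rewrite /dominating measure_addE fin_numD !fin_num_measure.
Qed.

HB.instance Definition _ (rho rho' : probability T R) :=
  Measure_isFinite.Build _ _ _ (dominating rho rho') (@dominating_fin rho rho').

(* The order-beta divergence formula for densities g, g' w.r.t. nu. The library
   conventions 0^-1 = 0 and ln 0 = 0 only matter where g' = 0 or g = 0: the
   integrands are then 0, the usual convention as soon as g = 0 nu-a.e. on
   g' = 0. *)
Definition renyi_formula (beta : R) (nu : set T -> \bar R) (g g' : T -> R) :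
    \bar R :=
  if beta == 1 then (\int[nu]_x (g x * ln (g x / g' x))%:E)%E
  else ((beta - 1)^-1%:E *
        lne (\int[nu]_x (g' x * (g x / g' x) `^ beta)%:E))%E.

Local Open Scope charge_scope.

(* The value does not depend on the common measure with respect to which
   densities are taken; we use rho + rho', which always dominates both. *)
Definition renyi (beta : R) (rho rho' : probability T R) : \bar R :=
  if `[< rho `<< rho' >] then
    let density (r : probability T R) :=
      fine \o 'd (charge_of_finite_measure r) '/d (dominating rho rho') in
    renyi_formula beta (dominating rho rho') (density rho) (density rho')
  else +oo%E.

End divergences.

(* R^n with its Borel sigma-algebra, in its product form (generated by the
   coordinates). The library puts normal_prob and lebesgue_measure on
   measurableTypeR R, which is R up to conversion. *)
Notation euclidean R n := (n.-tuple (measurableTypeR R)).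

Section euclidean_space.
Context (R : realType).

Definition l2_dist n (x y : euclidean R n) : R :=
  Num.sqrt (\sum_(i < n) ((tnth x i : R) - tnth y i) ^+ 2).

Definition cons_pair n (p : measurableTypeR R * euclidean R n) :
  euclidean R n.+1 := [tuple of p.1 :: p.2].

Let measurable_cons_pair n : measurable_fun setT (@cons_pair n).
Proof. exact: measurable_cons. Qed.

HB.instance Definition _ n :=
  isMeasurableFun.Build _ _ _ _ (@cons_pair n) (@measurable_cons_pair n).

(* N(x, s^2 I_n): the coordinates are independent and the i-th one is
   N(x_i, s^2), so s is the standard deviation, as in normal_prob. *)
Fixpoint gaussian_prob (s : R) (n : nat) :
    euclidean R n -> probability (euclidean R n) R :=
  match n with
  | 0 => fun=> \d_[tuple]
  | m.+1 => fun x => distribution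
      (normal_prob (thead x) s \x
         (gaussian_prob s [tuple of behead x] : probability (euclidean R m) R))%E
      (@cons_pair m)
  end.

Lemma gaussian_prob_box (s : R) n (x : euclidean R n)
    (A : 'I_n -> set (measurableTypeR R)) :
  (forall i, measurable (A i)) ->
  gaussian_prob s x [set y | forall i, A i (tnth y i)] =
  (\prod_(i < n) normal_prob (tnth x i) s (A i))%E.
Proof.
elim: n x A => [|n ih] x A mA.
  by rewrite big_ord0 /= diracE mem_set//= => -[].
have mB : measurable
    [set y : euclidean R n | forall i, A (lift ord0 i) (tnth y i)].
  rewrite (_ : [set y | _] = \bigcap_(i in [set: 'I_n])
      ((@tnth n (measurableTypeR R) ^~ i) @^-1` A (lift ord0 i))).
    apply: fin_bigcap_measurable; first exact: finite_finset.
    move=> i _; rewrite -[X in measurable X]setTI.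
    exact: measurable_tnth.
  by apply/seteqP; split => [y h i _|y h i]; exact: h.
rewrite big_ord_recl /= /distribution /pushforward /=.
set P1 := normal_prob (thead x) s; set P2 := gaussian_prob s _.
transitivity ((P1 \x P2)%E (A ord0 `*`
    [set y : euclidean R n | forall i, A (lift ord0 i) (tnth y i)])).
  congr (_ _); apply/seteqP; split => -[a y] /=.
    move=> h; split; first exact: (h ord0).
    by move=> i; have := h (lift ord0 i); rewrite tnthS.
  move=> [h0 h] i; case: (unliftP ord0 i) => [j ->|->//].
  by rewrite tnthS; exact: h.
rewrite product_measure1E//=; congr (_ * _)%E.
apply: (etrans (ih _ (fun i => A (lift ord0 i)) _)) => //.
apply: eq_bigr => i _.
by congr (normal_prob _ _ _); rewrite [in RHS](tuple_eta x) tnthS.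
Qed.

Definition std_normal_cdf (r : R) : R :=
  fine (normal_prob (0 : R) 1 `]-oo, r]%classic).

End euclidean_space.

Section classifiers.
Context (R : realType) (n K : nat).

Definition randomized_classifier := euclidean R n -> probability 'I_K.+1 R.

Definition robust (X : set (euclidean R n)) (m : randomized_classifier)
    (D : probability 'I_K.+1 R -> probability 'I_K.+1 R -> \bar R)
    (alpha eps : R) : Prop :=
  forall x x', X x -> X x' -> l2_dist x x' <= alpha ->
    (D (m x) (m x') <= eps%:E)%E.

Definition smoothed (c : {mfun euclidean R n >-> 'I_K.+1}) (s : R) :
    randomized_classifier :=
  fun x => distribution (gaussian_prob s x) c.

End classifiers.

(* Main.v *)
(* Write P = N(x, s^2 I), Q = N(x', s^2 I) and d = |x - x'|; the likelihood ratio
   L = dP/dQ is the exponential of an affine function.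

   Total variation: by the Neyman-Pearson argument, P - Q is maximal on the
   half-space L >= 1, which is a preimage of a half-line under y |-> <x - x', y>.
   That functional has laws N(<x - x', x>, s^2 d^2) and N(<x - x', x'>, s^2 d^2)
   under P and Q, whence the value 2 Phi(d / 2s) - 1.

   Renyi divergence: L^b is M = exp(b (b - 1) d^2 / 2s^2) times the likelihood
   ratio of N(x' + b (x - x'), s^2 I) with respect to Q. By convexity of u |-> u^b
   every event A satisfies Q(A) (P(A) / Q(A))^b <= int_A L^b dQ, and summing over
   the labels bounds the divergence sum by M. The case b = 1 follows by Jensen's
   inequality from the cases b > 1, letting b tend to 1. *)
Require Import Defs.
From mathcomp Require Import all_boot all_order all_algebra.
From mathcomp Require Import all_classical all_reals all_analysis.
From mathcomp Require Import measurable_realfun lebesgue_integral_fubini.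
From mathcomp Require Import ring lra.
Import Order.TTheory GRing.Theory Num.Theory.
Import numFieldNormedType.Exports.
Local Open Scope classical_set_scope.
Local Open Scope ring_scope.

(** * One-dimensional Gaussians *)

Section normal.
Context {R : realType}.
Local Notation mu := (@lebesgue_measure R).

(** The Radon-Nikodym derivative of [normal_prob m s] and [normal_pdf m s] have the same integral
    over every measurable set, so they agree almost everywhere. This turns Gaussian integrals into
    Lebesgue integrals. *)
Lemma integral_normal_prob (m s : R) (f : measurableTypeR R -> \bar R) :
  measurable_fun setT f -> (forall x, 0 <= f x)%E ->
  (\int[normal_prob m s]_x f x = \int[mu]_x (f x * (normal_pdf m s x)%:E))%E.
Proof.
move=> mf f0; have dom := normal_prob_dominates m s.
rewrite -(Radon_Nikodym_SigmaFinite.change_of_variables dom f0 measurableT) //.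
apply: ae_eq_integral => //.
- apply: emeasurable_funM => //.
  exact: measurable_int (Radon_Nikodym_SigmaFinite.f_integrable dom).
- apply: emeasurable_funM => //; apply/measurable_EFinP.
  exact: measurable_normal_pdf.
- apply: ae_eqe_mul2l; apply: integral_ae_eq => //.
  + exact: Radon_Nikodym_SigmaFinite.f_integrable.
  + by apply/measurable_EFinP; exact: measurable_normal_pdf.
  + by move=> E _ mE; rewrite -Radon_Nikodym_SigmaFinite.f_integral.
Qed.

(** * Affine changes of variable, for Lebesgue measure and for normal laws *)

Lemma measurable_affine (a b : R) :
  measurable_fun setT (fun x : measurableTypeR R => a * x + b : measurableTypeR R).
Proof. by apply: measurable_funD => //; exact: measurable_funM. Qed.

(** By uniqueness of Lebesgue measure it suffices to compare lengths of intervals []u, v]]. A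
    negative [a] turns the preimage into an interval closed on the left, of the same length. *)
Lemma lebesgue_measure_affine (a b : R) (A : set (measurableTypeR R)) :
  a != 0 -> measurable A ->
  mu A = (`|a|%:E * mu ((fun x => a * x + b)%R @^-1` A))%E.
Proof.
move=> a0 mA; pose k := NngNum (normr_ge0 a).
pose phi := fun x : measurableTypeR R => a * x + b : measurableTypeR R.
have mphi : measurable_fun setT phi := measurable_affine a b.
rewrite [RHS](_ : _ = mscale k (pushforward mu phi) A)//.
apply: lebesgue_measure_unique mA => // _ [[u v] /= _ <-].
rewrite /mscale /= /pushforward /k /phi /=.
have [ha|ha|/eqP] := ltgtP a 0; last by rewrite (negbTE a0).
- have -> : phi @^-1` `]u, v]%classic = `[(v - b) / a, (u - b) / a[%classic.
    apply/seteqP; split => x; rewrite /phi /= !in_itv /= => /andP[h1 h2].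
      by rewrite ler_ndivrMr// ltr_ndivlMr//; apply/andP; split; lra.
    by move: h1 h2; rewrite ler_ndivrMr// ltr_ndivlMr// => h1 h2; apply/andP; split; lra.
  rewrite !lebesgue_measure_itv /= !lte_fin ltr_ndivlMr// divfK// ltrD2r.
  case: ifPn => _; last by rewrite mule0.
  by rewrite -!EFinD -EFinM ltr0_norm//; congr (_%:E); field.
- have -> : phi @^-1` `]u, v]%classic = `](u - b) / a, (v - b) / a]%classic.
    apply/seteqP; split => x; rewrite /phi /= !in_itv /= => /andP[h1 h2].
      by rewrite ler_pdivlMr// ltr_pdivrMr//; apply/andP; split; lra.
    by move: h1 h2; rewrite ler_pdivlMr// ltr_pdivrMr// => h1 h2; apply/andP; split; lra.
  rewrite !lebesgue_measure_itv /= !lte_fin ltr_pdivrMr// divfK// ltrD2r.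
  case: ifPn => _; last by rewrite mule0.
  by rewrite -!EFinD -EFinM gtr0_norm//; congr (_%:E); field.
Qed.

Lemma integral_lebesgue_affine (a b : R) (f : measurableTypeR R -> \bar R) :
  a != 0 -> measurable_fun setT f -> (forall x, 0 <= f x)%E ->
  (\int[mu]_x f x = `|a|%:E * \int[mu]_x f (a * x + b)%R)%E.
Proof.
move=> a0 mf f0; pose k := NngNum (normr_ge0 a).
pose phi := fun x : measurableTypeR R => a * x + b : measurableTypeR R.
have mphi : measurable_fun setT phi := measurable_affine a b.
rewrite -[X in (_ * X)%E](@ge0_integral_pushforward _ _ _ _ _ _ mphi mu setT) //.
rewrite -(@ge0_integral_mscale _ _ _ _ setT measurableT k)//.
by apply: eq_measure_integral => // A mA _; exact: lebesgue_measure_affine.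
Qed.

(** The Jacobian [|a|] cancels against the normalising constant. The new scale [a * s] may be
    negative: the density only sees its square. *)
Lemma integral_normal_affine (m s a b : R) (f : measurableTypeR R -> \bar R) :
  s != 0 -> a != 0 -> measurable_fun setT f -> (forall x, 0 <= f x)%E ->
  (\int[normal_prob m s]_x f (a * x + b)%R =
   \int[normal_prob (a * m + b) (a * s)]_x f x)%E.
Proof.
move=> s0 a0 mf f0.
pose F x := (f x * (normal_pdf (a * m + b) (a * s) x)%:E)%E.
have mF : measurable_fun setT F.
  apply: emeasurable_funM => //; apply/measurable_EFinP.
  exact: measurable_normal_pdf.
have F0 x : (0 <= F x)%E by rewrite mule_ge0// lee_fin normal_pdf_ge0.
rewrite [RHS]integral_normal_prob// [RHS](integral_lebesgue_affine a b _ a0)//.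
rewrite [LHS]integral_normal_prob//; last first.
  exact: measurableT_comp mf (measurable_affine a b).
rewrite -ge0_integralZl//; last 2 first.
- exact: (measurableT_comp mF (measurable_affine a b)).
- by move=> x _; exact: F0.
apply: eq_integral => x _; rewrite muleCA; congr (_ * _)%E.
rewrite -EFinM; congr (_%:E).
rewrite !normal_pdfE ?mulf_neq0// /normal_peak /normal_fun mulrA.
have -> : (a * x + b - (a * m + b)) = a * (x - m) by ring.
rewrite !exprMn.
have -> : - (a ^+ 2 * (x - m) ^+ 2) / (a ^+ 2 * s ^+ 2 *+ 2) =
  - (x - m) ^+ 2 / (s ^+ 2 *+ 2) by field; rewrite s0 a0.
congr (_ * _).
have -> : a ^+ 2 * s ^+ 2 * pi *+ 2 = a ^+ 2 * (s ^+ 2 * pi *+ 2) by ring.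
rewrite sqrtrM ?sqr_ge0// sqrtr_sqr invfM mulrA.
by rewrite divff ?mul1r// normr_eq0.
Qed.

Lemma measure_integral_indic d (T : measurableType d)
    (m : {measure set T -> \bar R}) (A : set T) :
  measurable A -> m A = (\int[m]_x (\1_A x)%:E)%E.
Proof. by move=> mA; rewrite integral_indic// setIT. Qed.

Lemma normal_prob_affine (m s a b : R) (B : set (measurableTypeR R)) :
  s != 0 -> a != 0 -> measurable B ->
  normal_prob m s ((fun x => a * x + b) @^-1` B) =
  normal_prob (a * m + b) (a * s) B.
Proof.
move=> s0 a0 mB.
have mI : measurable_fun setT (fun v : measurableTypeR R => (\1_B v)%:E : \bar R).
  by apply/measurable_EFinP; exact: measurable_indic.
have I0 v : (0 <= (\1_B v)%:E :> \bar R)%E by rewrite lee_fin.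
apply: etrans (measure_integral_indic _ _ _ _ _) _.
  by rewrite -[X in measurable X]setTI; exact: (measurable_affine a b).
apply: etrans _ (esym (measure_integral_indic _ _ _ _ mB)).
exact: integral_normal_affine m s a b _ s0 a0 mI I0.
Qed.

(** Used to change the sign of a scale, or to pass between two expressions of the same variance. *)
Lemma eq_normal_prob (m s s' : R) : s ^+ 2 = s' ^+ 2 ->
  normal_prob m s = normal_prob m s'.
Proof.
move=> ss'; have s0 : (s == 0) = (s' == 0).
  by rewrite -[LHS](sqrf_eq0 s) ss' sqrf_eq0.
have pE : normal_pdf m s = normal_pdf m s'.
  by apply/funext => y; rewrite /normal_pdf /normal_peak /normal_fun s0 ss'.
by apply/funext => A; rewrite /normal_prob pE.
Qed.

(** * The standard normal distribution function *)

Lemma std_normal_cdf_le (t t' : R) : t <= t' -> std_normal_cdf t <= std_normal_cdf t'.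
Proof.
move=> tt'; rewrite /std_normal_cdf fine_le ?fin_num_measure//.
apply: le_measure; rewrite ?inE//.
by apply: subset_itvl; rewrite bnd_simp.
Qed.

(** By the symmetry [x |-> - x], the tail beyond [t] weighs as much as the half-line below [- t],
    which lies in []-oo, t]]. *)
Lemma half_le_std_normal_cdf (t : R) : 0 <= t -> 0 <= 2 * std_normal_cdf t - 1.
Proof.
move=> t0; pose B : set (measurableTypeR R) := `]t, +oo[%classic.
have BC : ~` B = `]-oo, t]%classic by rewrite setCitvr.
have mB : measurable B by exact: measurable_itv.
have N1 : (-1 : R) != 0 by rewrite oppr_eq0 oner_neq0.
have NB : normal_prob 0 1 ((fun x => -1 * x + 0) @^-1` B) = normal_prob 0 1 B.
  rewrite (normal_prob_affine 0 1 _ 0 B (oner_neq0 _) N1 mB) mulr0 addr0 mulr1.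
  by rewrite (eq_normal_prob 0 (-1) 1)// sqrrN.
have le1 : fine (normal_prob 0 1 B) <= std_normal_cdf t.
  rewrite -NB fine_le ?fin_num_measure//; last first.
  - apply: le_measure; rewrite ?inE//.
      by rewrite -[X in measurable X]setTI; exact: (measurable_affine (-1) 0).
    by move=> v; rewrite /preimage /B /= !in_itv/= ?andbT; lra.
  - by rewrite -[X in measurable X]setTI; exact: (measurable_affine (-1) 0).
have : std_normal_cdf t = 1 - fine (normal_prob 0 1 B).
  rewrite /std_normal_cdf -BC probability_setC// fineB// ?fin_num_measure//.
lra.
Qed.

(** The density of N(m, s^2) with respect to N(m', s^2); the normalising constants cancel because
    the variance is common. *)
Definition normal_lr (m m' s y : R) : R :=
  expR (((y - m') ^+ 2 - (y - m) ^+ 2) / (2 * s ^+ 2)).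

Lemma measurable_normal_lr (m m' s : R) :
  measurable_fun setT (normal_lr m m' s : measurableTypeR R -> R).
Proof.
apply: measurableT_comp => //; apply: measurable_funM => //.
by apply: measurable_funB; apply: measurable_funX; exact: measurable_funB.
Qed.

Lemma integral_normal_lr (m m' s : R) (f : measurableTypeR R -> \bar R) :
  s != 0 -> measurable_fun setT f -> (forall x, 0 <= f x)%E ->
  (\int[normal_prob m s]_x f x =
   \int[normal_prob m' s]_x (f x * (normal_lr m m' s x)%:E))%E.
Proof.
move=> s0 mf f0.
rewrite [LHS]integral_normal_prob//.
rewrite [RHS](integral_normal_prob _ _ (fun y => f y * _)%E); last 2 first.
- by apply: emeasurable_funM => //; apply/measurable_EFinP; exact: measurable_normal_lr.
- by move=> x; rewrite mule_ge0// lee_fin expR_ge0.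
apply: eq_integral => x _; rewrite -muleA; congr (_ * _)%E; rewrite -EFinM.
congr (_%:E); rewrite !normal_pdfE// /normal_fun mulrCA -expRD.
by congr (_ * expR _); field.
Qed.

(* Completing the square in [u]: the last factor is the conditional density of
   [u] given the value [v] of the noisy affine image of [u]. *)
Lemma normal_pdf_mul (m m' a b s u v : R) : b != 0 -> s != 0 ->
  let S := Num.sqrt (b ^+ 2 + a ^+ 2 * s ^+ 2) in
  normal_pdf m' s u * normal_pdf (m + a * u) b v =
  normal_pdf (m + a * m') S v *
  normal_pdf ((m' * b ^+ 2 + a * s ^+ 2 * (v - m)) / S ^+ 2) (s * b / S) u.
Proof.
move=> b0 s0 S.
have S2 : 0 < b ^+ 2 + a ^+ 2 * s ^+ 2.
  by rewrite ltr_pwDl ?exprn_even_gt0// mulr_ge0 ?sqr_ge0.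
have S0 : S != 0 by rewrite gt_eqF// sqrtr_gt0.
have SE : S ^+ 2 = b ^+ 2 + a ^+ 2 * s ^+ 2 by rewrite sqr_sqrtr// ltW.
rewrite !normal_pdfE ?mulf_neq0 ?invr_neq0// /normal_peak /normal_fun.
clearbody S.
rewrite mulrACA -invfM -expRD [RHS]mulrACA -invfM -expRD -!sqrtrM; last 2 first.
- by rewrite mulrn_wge0// mulr_ge0 ?pi_ge0 ?sqr_ge0.
- by rewrite mulrn_wge0// mulr_ge0 ?pi_ge0 ?sqr_ge0.
congr ((Num.sqrt _)^-1 * expR _).
  by rewrite exprMn exprMn exprVn; field.
rewrite exprMn exprVn exprMn SE.
field.
by rewrite exprMn s0 b0 gt_eqF.
Qed.

(** This is the law of [u + a * y] for independent normal [u] and [y]. The joint density of [y] and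
    the sum [v] factors as the marginal density of [v] times a conditional normal density of [y],
    which integrates to 1. *)
Lemma integral_normal_conv (m m' a b s : R) (f : measurableTypeR R -> \bar R) :
  b != 0 -> s != 0 -> measurable_fun setT f -> (forall x, 0 <= f x)%E ->
  (\int[normal_prob m' s]_y \int[normal_prob m b]_u f (u + a * y)%R =
   \int[normal_prob (m + a * m') (Num.sqrt (b ^+ 2 + a ^+ 2 * s ^+ 2))]_x f x)%E.
Proof.
move=> b0 s0 mf f0; set S := Num.sqrt _.
pose p (z : measurableTypeR R * measurableTypeR R) : R :=
  normal_pdf m' s z.1 * normal_pdf (m + a * z.1) b z.2.
have p_ge0 z : 0 <= p z by rewrite mulr_ge0 ?normal_pdf_ge0.
have mpdf2 : measurable_fun setT (fun z : measurableTypeR R * measurableTypeR R =>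
    normal_pdf (m + a * z.1) b z.2).
  (* The varying mean is moved into the argument, so that joint measurability follows from that of a
     single fixed density. *)
  rewrite (_ : (fun _ => _) = fun z => normal_pdf 0 b (z.2 - (m + a * z.1))); last first.
    by apply/funext => z; rewrite !normal_pdfE// /normal_fun subr0.
  apply: measurableT_comp; first exact: measurable_normal_pdf.
  apply: measurable_funB => //; apply: measurable_funD => //.
  exact: measurable_funM.
have mp : measurable_fun setT p.
  apply: measurable_funM => //.
  by apply: measurableT_comp => //; exact: measurable_normal_pdf.
pose g z := (f z.2 * (p z)%:E)%E.
have mg : measurable_fun setT g.
  apply: emeasurable_funM; first exact: measurableT_comp.
  exact/measurable_EFinP.
have g0 z : (0 <= g z)%E by rewrite mule_ge0// lee_fin.
transitivity (\int[mu]_y \int[mu]_v g (y, v))%E.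
  transitivity (\int[normal_prob m' s]_y
      \int[mu]_v (f v * (normal_pdf (m + a * y) b v)%:E))%E.
    apply: eq_integral => y _.
    rewrite -[RHS](integral_normal_prob (m + a * y) b f mf f0).
    have := integral_normal_affine m b 1 (a * y) f b0 (oner_neq0 _) mf f0.
    rewrite !mul1r => <-.
    by apply: eq_integral => u _; rewrite mul1r.
  rewrite integral_normal_prob//; last 2 first.
  - apply: (measurable_fun_fubini_tonelli_F
      (fun z => f z.2 * (normal_pdf (m + a * z.1) b z.2)%:E)%E) => //.
    + apply: emeasurable_funM; first exact: measurableT_comp.
      exact/measurable_EFinP.
    + by move=> z; rewrite mule_ge0// lee_fin normal_pdf_ge0.
  - by move=> y; apply: integral_ge0 => v _; rewrite mule_ge0// lee_fin normal_pdf_ge0.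
  apply: eq_integral => y _; rewrite -ge0_integralZr//; last 3 first.
  - by apply: emeasurable_funM => //; apply/measurable_EFinP; exact: measurable_normal_pdf.
  - by move=> v _; rewrite mule_ge0// lee_fin normal_pdf_ge0.
  - by rewrite lee_fin normal_pdf_ge0.
  by apply: eq_integral => v _; rewrite /g/= /p/= -muleA -EFinM [X in (_ * X%:E)%E]mulrC.
rewrite (fubini_tonelli g)//.
rewrite [RHS]integral_normal_prob//; apply: eq_integral => v _.
(* [M] is the conditional mean of [y] given [v]. *)
pose M := (m' * b ^+ 2 + a * s ^+ 2 * (v - m)) / S ^+ 2.
transitivity (\int[mu]_y
   (f v * (normal_pdf (m + a * m') S v)%:E * (normal_pdf M (s * b / S) y)%:E))%E.
  apply: eq_integral => y _; rewrite /g /= /p /= -muleA -EFinM.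
  by rewrite (normal_pdf_mul _ _ _ _ _ _ _ b0 s0).
rewrite ge0_integralZl//.
- by rewrite integral_normal_pdf mule1.
- by apply/measurable_EFinP; exact: measurable_normal_pdf.
- by move=> y _; rewrite lee_fin normal_pdf_ge0.
- by rewrite mule_ge0// lee_fin normal_pdf_ge0.
Qed.

End normal.

(** * Gaussians on R^n *)

Section gaussian.
Context {R : realType}.

(** * Splitting off the first coordinate, and likelihood ratios *)

Lemma measurable_cons_pair (n : nat) : measurable_fun setT (@cons_pair R n).
Proof. exact: measurable_cons. Qed.

Lemma integral_gaussianS (s : R) (n : nat) (x : euclidean R n.+1)
    (f : euclidean R n.+1 -> \bar R) :
  measurable_fun setT f -> (forall y, 0 <= f y)%E ->
  (\int[gaussian_prob s x]_y f y =
   \int[normal_prob (thead x) s]_a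
     \int[gaussian_prob s [tuple of behead x]]_y f [tuple of a :: y])%E.
Proof.
move=> mf f0.
have mg := measurableT_comp mf (measurable_cons_pair n).
rewrite ge0_integral_distribution//.
apply: (etrans (fubini_tonelli1 (m1 := normal_prob (thead x) s)
  (m2 := gaussian_prob s [tuple of behead x]) (f \o @cons_pair R n) mg _)).
  by move=> z; exact: f0.
by apply: eq_integral => a _; apply: eq_integral => y _; congr f; exact: val_inj.
Qed.

Lemma measurable_gaussian_section (s : R) (n : nat) (x : euclidean R n)
    (f : euclidean R n.+1 -> \bar R) :
  measurable_fun setT f -> (forall y, 0 <= f y)%E ->
  measurable_fun setT (fun a : measurableTypeR R =>
     \int[gaussian_prob s x]_y f [tuple of a :: y])%E.
Proof.
move=> mf f0.
apply: (measurable_fun_fubini_tonelli_F (m2 := gaussian_prob s x)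
  (f \o @cons_pair R n)); last by move=> z; exact: f0.
exact: measurableT_comp mf (measurable_cons_pair n).
Qed.

(** The density of N(x, s^2 I) with respect to N(x', s^2 I): the product of the coordinatewise
    ratios [normal_lr], gathered in one exponential. *)
Definition gaussian_lr (s : R) (n : nat) (x x' y : euclidean R n) : R :=
  expR ((\sum_(i < n) (((tnth y i : R) - tnth x' i) ^+ 2
    - ((tnth y i : R) - tnth x i) ^+ 2)) / (2 * s ^+ 2)).

Lemma gaussian_lr_ge0 (s : R) (n : nat) (x x' y : euclidean R n) :
  0 <= gaussian_lr s n x x' y.
Proof. exact: expR_ge0. Qed.

Lemma measurable_gaussian_lr (s : R) (n : nat) (x x' : euclidean R n) :
  measurable_fun setT (gaussian_lr s n x x').
Proof.
apply: measurableT_comp => //; apply: measurable_funM => //.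
apply: measurable_sum => i.
have mt : measurable_fun setT (fun y : euclidean R n => tnth y i : R).
  exact: measurable_tnth.
by apply: measurable_funB; apply: measurable_funX; exact: measurable_funB.
Qed.

Lemma tnth_behead (n : nat) (x : euclidean R n.+1) (i : 'I_n) :
  tnth [tuple of behead x] i = tnth x (lift ord0 i).
Proof. by rewrite [in RHS](tuple_eta x) tnthS. Qed.

Lemma gaussian_lr_cons (s : R) (n : nat) (x x' : euclidean R n.+1) (a : R)
    (y : euclidean R n) :
  gaussian_lr s n.+1 x x' [tuple of a :: y] =
  normal_lr (thead x) (thead x') s a *
  gaussian_lr s n [tuple of behead x] [tuple of behead x'] y.
Proof.
rewrite /gaussian_lr /normal_lr -expRD -mulrDl big_ord_recl.
under eq_bigr do rewrite tnthS -!tnth_behead.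
by [].
Qed.

(** Induction on the dimension: the first coordinate is handled by [integral_normal_lr], the others
    by the induction hypothesis, and the two ratios multiply. *)
Lemma integral_gaussian_lr (s : R) (n : nat) (x x' : euclidean R n)
    (f : euclidean R n -> \bar R) :
  s != 0 -> measurable_fun setT f -> (forall y, 0 <= f y)%E ->
  (\int[gaussian_prob s x]_y f y =
   \int[gaussian_prob s x']_y (f y * (gaussian_lr s n x x' y)%:E))%E.
Proof.
move=> s0; elim: n => [|n ih] in x x' f *.
  move=> mf f0; rewrite /= !integral_dirac//; last first.
    apply: emeasurable_funM => //; apply/measurable_EFinP.
    exact: measurable_gaussian_lr.
  by rewrite /gaussian_lr big_ord0 mul0r expR0 mule1.
move=> mf f0.
have mfa a : measurable_fun setT (fun y : euclidean R n => f [tuple of a :: y]).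
  pose g (y : euclidean R n) : euclidean R n.+1 := [tuple of a :: y].
  have mg : measurable_fun setT g.
    by apply: measurable_cons; [exact: measurable_cst|exact: measurable_id].
  exact: (measurableT_comp mf mg).
pose g y := (f y * (gaussian_lr s n.+1 x x' y)%:E)%E.
have mg : measurable_fun setT g.
  apply: emeasurable_funM => //; apply/measurable_EFinP.
  exact: measurable_gaussian_lr.
have g0 y : (0 <= g y)%E by rewrite mule_ge0// lee_fin gaussian_lr_ge0.
rewrite [LHS](integral_gaussianS s n x f mf f0).
rewrite [RHS](integral_gaussianS s n x' g mg g0).
rewrite [LHS](integral_normal_lr (thead x) (thead x') s)//; last 2 first.
- exact: measurable_gaussian_section.
- by move=> a; exact: integral_ge0.
apply: eq_integral => a _.
rewrite (ih _ [tuple of behead x'])//.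
rewrite -ge0_integralZr//; last 3 first.
- apply: emeasurable_funM => //; apply/measurable_EFinP.
  exact: measurable_gaussian_lr.
- by move=> y _; rewrite mule_ge0// lee_fin gaussian_lr_ge0.
- by rewrite lee_fin expR_ge0.
by apply: eq_integral => y _; rewrite /g gaussian_lr_cons -muleA -EFinM mulrC.
Qed.

(** * Linear functionals of a Gaussian vector *)

Definition dot (n : nat) (a : 'I_n -> R) (y : euclidean R n) : R :=
  \sum_(i < n) a i * (tnth y i : R).

Lemma measurable_dot (n : nat) (a : 'I_n -> R) :
  measurable_fun setT (dot n a : _ -> measurableTypeR R).
Proof.
apply: measurable_sum => i; apply: measurable_funM => //.
exact: measurable_tnth.
Qed.

Lemma dotS (n : nat) (a : 'I_n.+1 -> R) (x : euclidean R n.+1) :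
  dot n.+1 a x = a ord0 * (thead x : R)
    + dot n (fun i => a (lift ord0 i)) [tuple of behead x].
Proof.
rewrite /dot big_ord_recl; congr (_ + _).
by apply: eq_bigr => i _; rewrite tnth_behead.
Qed.

Lemma sum_sqr_eq0 (n : nat) (a : 'I_n -> R) :
  \sum_(i < n) a i ^+ 2 = 0 -> forall i, a i = 0.
Proof.
move=> /eqP a0 i; apply/eqP; rewrite -sqrf_eq0; move: a0.
by rewrite psumr_eq0 => [/allP/(_ i)/(_ (mem_index_enum _))//|j _]; exact: sqr_ge0.
Qed.

(** Induction on the dimension: the first coordinate adds an independent normal variable to the
    functional of the remaining ones, and variances add by [integral_normal_conv]. *)
Lemma integral_gaussian_dot (s : R) (n : nat) (a : 'I_n -> R)
    (x : euclidean R n) (f : measurableTypeR R -> \bar R) :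
  s != 0 -> \sum_(i < n) a i ^+ 2 != 0 ->
  measurable_fun setT f -> (forall y, 0 <= f y)%E ->
  (\int[gaussian_prob s x]_y f (dot n a y) =
   \int[normal_prob (dot n a x) (s * Num.sqrt (\sum_(i < n) a i ^+ 2))]_v f v)%E.
Proof.
move=> s0; elim: n => [|n ih] in a x f *; first by rewrite big_ord0 eqxx.
pose a' (i : 'I_n) := a (lift ord0 i).
have sE : \sum_(i < n.+1) a i ^+ 2 = a ord0 ^+ 2 + \sum_(i < n) a' i ^+ 2.
  by rewrite big_ord_recl.
have s'0 : 0 <= \sum_(i < n) a' i ^+ 2 by apply: sumr_ge0 => i _; exact: sqr_ge0.
move=> a0 mf f0.
have mF : measurable_fun setT (fun y => f (dot n.+1 a y)).
  exact: measurableT_comp mf (measurable_dot _ _).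
rewrite [LHS](integral_gaussianS s n x _ mF (fun y => f0 _)).
have dE (u : measurableTypeR R) (y : euclidean R n) :
    dot n.+1 a [tuple of u :: y] = dot n a' y + a ord0 * u.
  rewrite dotS addrC theadE; congr (dot _ _ _ + _).
  exact: val_inj.
transitivity (\int[normal_prob (thead x) s]_u
    \int[gaussian_prob s [tuple of behead x]]_y f (dot n a' y + a ord0 * u)%R)%E.
  by apply: eq_integral => u _; apply: eq_integral => y _; rewrite dE.
(* If the tail of [a] vanishes, the functional of the remaining coordinates is constant and has no
   density; only the affine image of the first coordinate is left. *)
have [a'0|a'0] := eqVneq (\sum_(i < n) a' i ^+ 2) 0.
- have a'00 := sum_sqr_eq0 n a' a'0.
  have d0 y : dot n a' y = 0 by apply: big1 => i _; rewrite a'00 mul0r.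
  transitivity (\int[normal_prob (thead x) s]_u f (a ord0 * u + 0)%R)%E.
    apply: eq_integral => u _.
    under eq_integral do rewrite d0 add0r.
    rewrite integral_cst// addr0 -[RHS]mule1; congr (_ * _)%E.
    exact: probability_setT.
  have a00 : a ord0 != 0 by move: a0; rewrite sE a'0 addr0 sqrf_eq0.
  rewrite (integral_normal_affine _ _ _ _ _ s0 a00 mf f0).
  rewrite dotS d0 sE a'0 !addr0.
  rewrite (eq_normal_prob _ _ (s * Num.sqrt (a ord0 ^+ 2)))//.
  by rewrite !exprMn sqr_sqrtr ?sqr_ge0// mulrC.
- pose b := s * Num.sqrt (\sum_(i < n) a' i ^+ 2).
  have b0 : b != 0 by rewrite mulf_neq0// gt_eqF// sqrtr_gt0 lt_neqAle eq_sym a'0.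
  transitivity (\int[normal_prob (thead x) s]_u
      \int[normal_prob (dot n a' [tuple of behead x]) b]_v f (v + a ord0 * u)%R)%E.
    apply: eq_integral => u _.
    apply: (ih a' _ (fun v => f (v + a ord0 * u)%R)) => //.
    pose h (v : measurableTypeR R) : measurableTypeR R := v + a ord0 * u.
    have mh : measurable_fun setT h by exact: measurable_funD.
    exact: (measurableT_comp mf mh).
  rewrite (integral_normal_conv _ _ _ _ _ _ b0 s0 mf f0).
  rewrite dotS addrC.
  rewrite (eq_normal_prob _ _ (s * Num.sqrt (\sum_(i < n.+1) a i ^+ 2)))//.
  have t'0 : 0 <= a ord0 ^+ 2 + \sum_(i < n) a' i ^+ 2 by rewrite addr_ge0// sqr_ge0.
  rewrite sE sqr_sqrtr; last by rewrite -exprMn addr_ge0// sqr_ge0.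
  rewrite /b !exprMn !sqr_sqrtr//.
  by ring.
Qed.

Lemma gaussian_prob_lr (s : R) (n : nat) (x x' : euclidean R n)
    (A : set (euclidean R n)) : s != 0 -> measurable A ->
  (gaussian_prob s x A =
   \int[gaussian_prob s x']_(y in A) (gaussian_lr s n x x' y)%:E)%E.
Proof.
move=> s0 mA; rewrite measure_integral_indic//.
have mI : measurable_fun setT (fun y : euclidean R n => (\1_A y)%:E : \bar R).
  by apply/measurable_EFinP; exact: measurable_indic.
rewrite (integral_gaussian_lr s n x x' _ s0 mI); last by move=> y; rewrite lee_fin.
rewrite [RHS]integral_mkcond; apply: eq_integral => y _.
by rewrite epatch_indic muleC.
Qed.

(** Here [r] is either square root of the variance. The negative one serves to turn an upper
    half-line into a lower one. *)
Lemma gaussian_prob_dot (s : R) (n : nat) (a : 'I_n -> R) (x : euclidean R n)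
    (r : R) (B : set (measurableTypeR R)) :
  r != 0 -> r ^+ 2 = s ^+ 2 * \sum_(i < n) a i ^+ 2 -> measurable B ->
  gaussian_prob s x (dot n a @^-1` B) =
  normal_prob 0 1 ((fun z => r * z + dot n a x) @^-1` B).
Proof.
move=> r0 rE mB.
have : s ^+ 2 * \sum_(i < n) a i ^+ 2 != 0 by rewrite -rE sqrf_eq0.
rewrite mulf_eq0 sqrf_eq0 negb_or => /andP[s0 a0].
have mI : measurable_fun setT (fun v : measurableTypeR R => (\1_B v)%:E : \bar R).
  by apply/measurable_EFinP; exact: measurable_indic.
have I0 v : (0 <= (\1_B v)%:E :> \bar R)%E by rewrite lee_fin.
have rE' : r ^+ 2 = (s * Num.sqrt (\sum_(i < n) a i ^+ 2)) ^+ 2.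
  rewrite rE exprMn sqr_sqrtr; first by [].
  by apply: sumr_ge0 => i _; exact: sqr_ge0.
rewrite (normal_prob_affine 0 1 r _ _ (oner_neq0 _) r0 mB).
rewrite mulr0 add0r mulr1 (eq_normal_prob _ _ _ rE').
apply: etrans (measure_integral_indic _ _ _ _ _) _.
  by rewrite -[X in measurable X]setTI; exact: measurable_dot.
apply: etrans _ (esym (measure_integral_indic _ _ _ _ mB)).
exact: integral_gaussian_dot s n a x _ s0 a0 mI I0.
Qed.

(** The quadratic terms in [y] cancel, so the ratio depends on [y] through [dot n a y] alone; it
    equals 1 where that value is the one at the midpoint of [x] and [x']. *)
Lemma gaussian_lr_dot (s : R) (n : nat) (x x' y : euclidean R n) :
  let a i := (tnth x i : R) - tnth x' i in
  gaussian_lr s n x x' y =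
  expR ((dot n a y - (dot n a x + dot n a x') / 2) / s ^+ 2).
Proof.
move=> a; rewrite /gaussian_lr; congr expR.
have -> : \sum_(i < n) (((tnth y i : R) - tnth x' i) ^+ 2 - ((tnth y i : R) - tnth x i) ^+ 2)
   = 2 * dot n a y - (dot n a x + dot n a x').
  rewrite /dot mulr_sumr -big_split -sumrB /=; apply: eq_bigr => i _.
  by rewrite /a; ring.
by rewrite invfM mulrA; congr (_ / _); field.
Qed.

(** * Total variation between two translates of a Gaussian *)

Lemma dist_dot (n : nat) (x x' : euclidean R n) :
  let a i := (tnth x i : R) - tnth x' i in
  dot n a x - dot n a x' = \sum_(i < n) a i ^+ 2.
Proof. by move=> a; rewrite /dot -sumrB; apply: eq_bigr => i _; rewrite /a; ring. Qed.

Lemma gaussian_prob_sub_le (s : R) (n : nat) (x x' : euclidean R n)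
    (A : set (euclidean R n)) : 0 < s -> measurable A ->
  fine (gaussian_prob s x A) - fine (gaussian_prob s x' A) <=
  2 * std_normal_cdf (l2_dist x x' / (2 * s)) - 1.
Proof.
move=> s0 mA.
pose a i := (tnth x i : R) - tnth x' i; pose d := l2_dist x x'.
have d0 : 0 <= d by exact: sqrtr_ge0.
have dE : d ^+ 2 = \sum_(i < n) a i ^+ 2.
  by rewrite sqr_sqrtr; last by apply: sumr_ge0 => i _; exact: sqr_ge0.
(* For [d = 0] the direction [a] vanishes and [dot n a] has no normal density; the two laws then
   coincide. *)
have [/eqP d_eq0|d_neq0] := boolP (d == 0).
  suff -> : x = x'.
    by rewrite subrr half_le_std_normal_cdf // divr_ge0 ?sqrtr_ge0// mulr_ge0// ltW.
  apply: eq_from_tnth => i; apply/eqP; rewrite -subr_eq0; apply/eqP.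
  by apply: (sum_sqr_eq0 n a); rewrite -dE d_eq0 expr0n.
have d_gt0 : 0 < d by rewrite lt_neqAle eq_sym d_neq0.
have dotE : dot n a x - dot n a x' = d ^+ 2 by rewrite dE dist_dot.
pose tau := (dot n a x + dot n a x') / 2.
(* the Neyman-Pearson region [gaussian_lr >= 1] *)
pose H : set (euclidean R n) := dot n a @^-1` `[tau, +oo[%classic.
have mH : measurable H.
  by rewrite -[X in measurable X]setTI; exact: measurable_dot.
have HC : ~` H = dot n a @^-1` `]-oo, tau[%classic.
  by rewrite /H preimage_setC setCitvr.
pose P A := fine (gaussian_prob s x A); pose Q A := fine (gaussian_prob s x' A).
have PQ B : measurable B -> B `<=` ~` H -> P B <= Q B.
  move=> mB BH; rewrite fine_le ?fin_num_measure// (gaussian_prob_lr s n x x') ?gt_eqF//.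
  rewrite -[leRHS]mul1e -integral_cst//; apply: ge0_le_integral => //.
  - by move=> y _; rewrite lee_fin gaussian_lr_ge0.
  - by apply/measurable_EFinP/measurable_funTS; exact: measurable_gaussian_lr.
  - move=> y /BH; rewrite HC /= in_itv/= => ytau.
    rewrite lee_fin gaussian_lr_dot -[leRHS]expR0 ler_expR.
    by rewrite pmulr_lle0 ?invr_gt0 ?exprn_gt0// subr_le0 ltW.
have QP B : measurable B -> B `<=` H -> Q B <= P B.
  move=> mB BH; rewrite fine_le ?fin_num_measure// (gaussian_prob_lr s n x x') ?gt_eqF//.
  rewrite -[leLHS]mul1e -integral_cst//; apply: ge0_le_integral => //.
  - by apply/measurable_EFinP/measurable_funTS; exact: measurable_gaussian_lr.
  - move=> y /BH; rewrite /H /= in_itv/= andbT => ytau.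
    rewrite lee_fin gaussian_lr_dot -[leLHS]expR0 ler_expR.
    by rewrite pmulr_lge0 ?invr_gt0 ?exprn_gt0// subr_ge0.
have PD (z : euclidean R n) B C : measurable B -> measurable C ->
    fine (gaussian_prob s z B) =
    fine (gaussian_prob s z (B `\` C)) + fine (gaussian_prob s z (B `&` C)).
  move=> mB mC; rewrite -fineD ?fin_num_measure//; try exact: measurableD; try exact: measurableI.
  by rewrite -measureDI.
have PH : P H = std_normal_cdf (d / (2 * s)).
  (* Under P the functional exceeds [tau] by [d ^+ 2 / 2] on average. With the negative scale, the
     condition of lying above [tau] becomes [z <= d / (2 * s)]. *)
  rewrite /P /H (gaussian_prob_dot _ _ _ _ (- (s * d)))//; last 2 first.
  - by rewrite oppr_eq0 mulf_neq0 ?gt_eqF.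
  - by rewrite sqrrN exprMn dE.
  congr (fine (normal_prob _ _ _)); apply/seteqP; split => z;
      rewrite /preimage /= !in_itv/= ?andbT /tau.
    by move=> h; rewrite ler_pdivlMr ?mulr_gt0// -(ler_pM2l d_gt0); lra.
  by rewrite ler_pdivlMr ?mulr_gt0// -(ler_pM2l d_gt0); lra.
(* The complement of [H] gives the open half-line [z < d / (2 * s)], while the distribution function
   uses the closed one; an inequality is enough. *)
have QH : 1 - std_normal_cdf (d / (2 * s)) <= Q H.
  have : Q (~` H) = 1 - Q H.
    by rewrite /Q probability_setC// fineB// fin_num_measure.
  suff : Q (~` H) <= std_normal_cdf (d / (2 * s)) by lra.
  have sd0 : s * d != 0 by rewrite mulf_neq0 ?gt_eqF.
  have sdE : (s * d) ^+ 2 = s ^+ 2 * \sum_(i < n) a i ^+ 2 by rewrite exprMn dE.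
  have mt : measurable (`]-oo, tau[%classic : set (measurableTypeR R)).
    exact: measurable_itv.
  have mp : measurable ((fun z => s * d * z + dot n a x') @^-1`
      (`]-oo, tau[%classic : set (measurableTypeR R))).
    by rewrite -[X in measurable X]setTI; exact: (measurable_affine (s * d)).
  rewrite /Q HC (gaussian_prob_dot s n a x' (s * d) _ sd0 sdE mt).
  rewrite fine_le ?fin_num_measure//.
  apply: le_measure; rewrite ?inE//.
  move=> z; rewrite /preimage /= !in_itv/= ?andbT /tau => h.
  by rewrite ler_pdivlMr ?mulr_gt0// -(ler_pM2l d_gt0); lra.
(* Dropping [A] minus [H] and adding [H] minus [A] can only increase P - Q, so its value at [A] is
   at most its value at [H]. *)
have := PQ (A `\` H) (measurableD mA mH) (@subIsetr _ _ _).
have := QP (H `\` A) (measurableD mH mA) (@subDsetl _ _ _).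
have : P A = P (A `\` H) + P (A `&` H) := PD x A H mA mH.
have : Q A = Q (A `\` H) + Q (A `&` H) := PD x' A H mA mH.
have : P H = P (H `\` A) + P (H `&` A) := PD x H A mH mA.
have : Q H = Q (H `\` A) + Q (H `&` A) := PD x' H A mH mA.
rewrite [H `&` A]setIC -/(P A) -/(Q A) -/d; lra.
Qed.

(** * The convexity bound for powers of likelihood ratios *)

Lemma integral_affine_lr (s : R) (n : nat) (x x' : euclidean R n)
    (A : set (euclidean R n)) (k l : R) :
  s != 0 -> 0 <= k -> 0 <= l -> measurable A ->
  (\int[gaussian_prob s x']_(y in A) (k + l * gaussian_lr s n x x' y)%:E =
   k%:E * gaussian_prob s x' A + l%:E * gaussian_prob s x A)%E.
Proof.
move=> s0 k0 l0 mA.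
have mlr : measurable_fun A (fun y => (gaussian_lr s n x x' y)%:E).
  by apply/measurable_EFinP/measurable_funTS; exact: measurable_gaussian_lr.
under eq_integral do rewrite EFinD EFinM.
rewrite ge0_integralD//; last 2 first.
- by move=> y _; rewrite mule_ge0// lee_fin gaussian_lr_ge0.
- exact: measurable_funeM.
rewrite integral_cst// ge0_integralZl//; last first.
  by move=> y _; rewrite lee_fin gaussian_lr_ge0.
by rewrite -gaussian_prob_lr.
Qed.

(* The tangent line of [v |-> v ^ b] at [expR t], evaluated at [expR u]. *)
Lemma powR_tangent (b t u : R) : 1 <= b ->
  expR (b * t) + b * expR ((b - 1) * t) * expR u <= expR (b * u) + b * expR (b * t).
Proof.
move=> b1.
have e1 : 1 + (b - 1) * (u - t) <= expR ((b - 1) * (u - t)) by exact: expR_ge1Dx.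
have e2 : 1 + (t - u) <= expR (t - u) by exact: expR_ge1Dx.
have b10 : 0 <= b - 1 by lra.
have e3 : (b - 1) * (1 + (t - u)) <= (b - 1) * expR (t - u) by exact: ler_wpM2l.
have e4 : b <= expR ((b - 1) * (u - t)) + (b - 1) * expR (t - u) by lra.
have e5 := ler_wpM2l (expR_ge0 ((b - 1) * t + u)) e4.
move: e5; rewrite mulrDr mulrCA -!expRD.
have -> : (b - 1) * t + u + (b - 1) * (u - t) = b * u by ring.
have -> : (b - 1) * t + u + (t - u) = b * t by ring.
rewrite expRD; lra.
Qed.

(** The tangent inequality for the power [b] is integrated over [A]. Since [z] is chosen before [A],
    the bounds for the cells of a partition add up to the exponential factor alone. *)
Lemma gaussian_prob_powR_le (s : R) (n : nat) (x x' : euclidean R n) (b : R) :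
  0 < s -> 1 <= b -> exists z : euclidean R n,
  forall A : set (euclidean R n), measurable A ->
  fine (gaussian_prob s x' A) *
    (fine (gaussian_prob s x A) / fine (gaussian_prob s x' A)) `^ b <=
  expR (b * (b - 1) * l2_dist x x' ^+ 2 / (2 * s ^+ 2)) * fine (gaussian_prob s z A).
Proof.
move=> s0 b1; have sn0 : s != 0 by rewrite gt_eqF.
(* Completing the square in the [b]-th power of the ratio gives a Gaussian centred at
   [x' + b (x - x')]; the constant left over is [M]. *)
pose z : euclidean R n :=
  [tuple ((tnth x' i : R) + b * ((tnth x i : R) - tnth x' i) : measurableTypeR R) | i < n].
exists z => A mA.
set p := fine (gaussian_prob s x A); set q := fine (gaussian_prob s x' A).
set M := expR _.
have M0 : 0 <= M by exact: expR_ge0.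
have p0 : 0 <= p by rewrite fine_ge0.
(* If [q = 0] the left side vanishes through its first factor, whatever the default value of
   [p / q]; if [p = 0] the power vanishes because [b] is nonzero. *)
have [q_le0|q0] := leP q 0.
  have -> : q = 0 by apply/eqP; rewrite eq_le q_le0 fine_ge0.
  by rewrite mul0r mulr_ge0// fine_ge0.
have [p_le0|p_gt0] := leP p 0.
  have -> : p = 0 by apply/eqP; rewrite eq_le p_le0 p0.
  rewrite mul0r powR0 ?mulr0; last by rewrite gt_eqF//; lra.
  by rewrite mulr_ge0// fine_ge0.
have pq0 : 0 < p / q by rewrite divr_gt0.
pose t := ln (p / q).
have powE r : (p / q) `^ r = expR (r * t) by rewrite /powR gt_eqF.
pose a i := (tnth x i : R) - tnth x' i.
have dzE w : dot n (fun i => (tnth z i : R) - tnth x' i) w = b * dot n a w.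
  rewrite /dot mulr_sumr; apply: eq_bigr => i _.
  by rewrite /z tnth_mktuple /a; ring.
have azE : dot n a z = dot n a x' + b * (dot n a x - dot n a x').
  rewrite /dot -sumrB mulr_sumr -big_split; apply: eq_bigr => i _ /=.
  by rewrite /z tnth_mktuple /a; ring.
have lrE y : expR (b * ((dot n a y - (dot n a x + dot n a x') / 2) / s ^+ 2)) =
    M * gaussian_lr s n z x' y.
  rewrite gaussian_lr_dot -expRD; congr expR.
  rewrite sqr_sqrtr; last by apply: sumr_ge0 => i _; exact: sqr_ge0.
  rewrite -dist_dot -/a !dzE azE.
  by field.
pose lr := gaussian_lr s n x x'.
have mlr w k l : measurable_fun A (fun y => (k + l * gaussian_lr s n w x' y)%:E).
  apply/measurable_EFinP/measurable_funTS.
  apply: measurable_funD => //; apply: measurable_funM => //.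
  exact: measurable_gaussian_lr.
(* the tangent is taken at [p / q], the [Q]-average of [lr] over [A] *)
have : (\int[gaussian_prob s x']_(y in A)
    (expR (b * t) + b * expR ((b - 1) * t) * lr y)%:E <=
  \int[gaussian_prob s x']_(y in A)
    (b * expR (b * t) + M * gaussian_lr s n z x' y)%:E)%E.
  apply: ge0_le_integral => //.
  - by move=> y _; rewrite lee_fin addr_ge0 ?mulr_ge0 ?expR_ge0//; lra.
  - exact: (mlr x (expR (b * t)) (b * expR ((b - 1) * t))).
  - move=> y _; rewrite lee_fin -lrE /lr gaussian_lr_dot.
    by rewrite [leRHS]addrC powR_tangent.
rewrite integral_affine_lr ?expR_ge0 ?mulr_ge0 ?expR_ge0//; try lra.
rewrite integral_affine_lr ?expR_ge0 ?mulr_ge0 ?expR_ge0//; try lra.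
have fE w : gaussian_prob s w A = (fine (gaussian_prob s w A))%:E.
  by rewrite fineK ?fin_num_measure.
rewrite (fE x) (fE x') (fE z) -/p -/q -!EFinM -!EFinD lee_fin powE.
(* As [expR t = p / q], the linear terms of the tangent inequality integrate to the same number on
   both sides and cancel. *)
have -> : b * expR ((b - 1) * t) * p = b * expR (b * t) * q.
  have -> : p = expR t * q by rewrite lnK ?divfK ?gt_eqF.
  rewrite mulrA -[_ * _ * expR t]mulrA -expRD; congr (_ * expR _ * _).
  by ring.
lra.
Qed.

End gaussian.

(** * Renyi divergence between laws on finitely many labels *)

Section discrete.
Context {R : realType}.

(** The power sum is the [p]-average of the exponential of [(b - 1) * ln (p i / q i)], so Jensen's
    inequality bounds the sum [L] by [b * D] for every [b > 1]. *)
Lemma kl_le_of_powR_sum_le (I : finType) (p q : I -> R) (D : R) :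
  (forall i, 0 <= p i) -> (forall i, 0 <= q i) -> (forall i, q i = 0 -> p i = 0) ->
  \sum_i p i = 1 -> 0 <= D ->
  (forall b, 1 < b -> \sum_i q i * (p i / q i) `^ b <= expR (b * (b - 1) * D)) ->
  \sum_i p i * ln (p i / q i) <= D.
Proof.
move=> p0 q0 pq p1 D0 SD; set L := \sum_i _.
suff LD b : 1 < b -> L <= b * D.
  apply/ler_addgt0Pr => e e0.
  have D1 : 0 < D + 1 by lra.
  (* With this [b] the excess [(b - 1) * D] is at most [e]; the denominator [D + 1] stays positive
     when [D = 0]. *)
  have /LD : 1 < 1 + e / (D + 1) by rewrite ltrDl divr_gt0.
  move=> /le_trans; apply; rewrite mulrDl mul1r lerD2l.
  by rewrite mulrAC ler_pdivrMr// ler_pM2l//; lra.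
move=> b1; have b10 : 0 < b - 1 by lra.
rewrite -(ler_pM2l b10); set m := (b - 1) * L.
have -> : (b - 1) * (b * D) = b * (b - 1) * D by ring.
(* Jensen's inequality for [expR], through its tangent at [m] *)
rewrite -ler_expR; apply: le_trans (SD _ b1).
(* The first-order terms cancel because [m] is the [p]-average of [(b - 1) * ln (p i / q i)]. *)
have -> : expR m = \sum_i p i * (expR m * (1 + ((b - 1) * ln (p i / q i) - m))).
  rewrite (eq_bigr (fun i => expR m * (1 - m) * p i +
     expR m * (b - 1) * (p i * ln (p i / q i)))); last by move=> i _; ring.
  by rewrite big_split /= -!mulr_sumr p1 -/L /m; ring.
apply: ler_sum => i _.
have [pi0|pi0] := eqVneq (p i) 0.
  by rewrite pi0 mul0r mulr_ge0 ?powR_ge0.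
have qi0 : q i != 0 by apply: contra_neq pi0 => /pq.
have pi_gt0 : 0 < p i by rewrite lt_neqAle eq_sym pi0 p0.
have qi_gt0 : 0 < q i by rewrite lt_neqAle eq_sym qi0 q0.
have pq0 : 0 < p i / q i by rewrite divr_gt0.
set t := ln (p i / q i).
have -> : q i * (p i / q i) `^ b = p i * expR ((b - 1) * t).
  rewrite /powR gt_eqF// -/t (_ : b * t = t + (b - 1) * t); last by ring.
  by rewrite expRD [X in _ * (X * _)]lnK// mulrA mulrCA divff ?mulr1.
apply: ler_wpM2l => //.
rewrite -[(b - 1) * t](subrK m) [X in _ <= expR X]addrC expRD.
by rewrite addrK ler_wpM2l ?expR_ge0// expR_ge1Dx.
Qed.

Context (K : nat).
Local Notation T := 'I_K.+1.

(** * Integrals and densities on a finite discrete space *)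

Lemma integral_set1_discrete (m : {measure set T -> \bar R}) (f : T -> \bar R) (k : T) :
  (\int[m]_(x in [set k]) f x = f k * m [set k])%E.
Proof.
rewrite -integral_cst//; apply: eq_integral => x.
by rewrite inE => ->.
Qed.

Lemma integral_discrete (m : {measure set T -> \bar R}) (f : T -> R) :
  (forall k, m [set k] \is a fin_num) ->
  (\int[m]_x (f x)%:E = (\sum_k f k * fine (m [set k]))%:E)%E.
Proof.
move=> mfin.
have -> : [set: T] = \big[setU/set0]_(k <- enum T) [set k].
  apply/seteqP; split => // k _.
  by rewrite -bigcup_seq /=; exists k => //=; rewrite mem_enum.
rewrite integral_bigsetU_EFin ?enum_uniq//.
- rewrite big_enum /= -sumEFin; apply: eq_bigr => k _.
  by rewrite integral_set1_discrete EFinM fineK.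
- by apply/trivIsetP => i j _ _ /eqP ij; apply/seteqP; split => // x [-> /ij].
Qed.

Lemma sum_probability_set1 (m : probability T R) :
  \sum_k fine (m [set k]) = 1.
Proof.
have m1 : (\int[m]_x 1%:E = 1)%E.
  by rewrite integral_cst// mul1e; exact: probability_setT.
have mfin k : m [set k] \is a fin_num by rewrite fin_num_measure.
move: m1; rewrite (integral_discrete m (fun=> 1) mfin) => -[<-].
by apply: eq_bigr => k _; rewrite mul1r.
Qed.

Local Open Scope charge_scope.

(** Integrating the derivative over a singleton determines its value at each label of positive mass,
    although it is only defined almost everywhere. *)
Lemma Radon_Nikodym_set1 (r m : {finite_measure set T -> \bar R}) (k : T) :
  r `<< m ->
  fine (r [set k]) =
  fine (('d (charge_of_finite_measure r) '/d m) k) * fine (m [set k]).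
Proof.
move=> rm.
have rm' : charge_of_finite_measure r `<< m by [].
have mk : measurable [set k] by [].
have -> : r [set k] = (('d (charge_of_finite_measure r) '/d m) k * m [set k])%E.
  by rewrite -integral_set1_discrete; exact: (Radon_Nikodym_integral rm' mk).
rewrite fineM// ?fin_num_measure//.
exact: Radon_Nikodym_fin_num.
Qed.

(** At a label charged by the dominating measure, both densities carry the same denominator
    [p k + q k], which disappears from their ratio. *)
Lemma renyi_discrete (b : R) (r r' : probability T R) : r `<< r' ->
  let p k := fine (r [set k]) in let q k := fine (r' [set k]) in
  renyi b r r' =
  if b == 1 then (\sum_k p k * ln (p k / q k))%:E
  else ((b - 1)^-1%:E * lne (\sum_k q k * (p k / q k) `^ b)%:E)%E.
Proof.
move=> rr' p q; rewrite /renyi asboolT// /renyi_formula.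
pose nu : {finite_measure set T -> \bar R} := dominating r r'.
have nuE k : fine (nu [set k]) = p k + q k.
  by rewrite /nu /= /dominating measure_addE fineD ?fin_num_measure.
have rnu : r `<< nu.
  apply/null_content_dominatesP => A mA; rewrite /nu /= /dominating measure_addE => /eqP.
  by rewrite padde_eq0// => /andP[/eqP].
have r'nu : r' `<< nu.
  apply/null_content_dominatesP => A mA; rewrite /nu /= /dominating measure_addE => /eqP.
  by rewrite padde_eq0// => /andP[_ /eqP].
have pE k := Radon_Nikodym_set1 _ _ k rnu.
have qE k := Radon_Nikodym_set1 _ _ k r'nu.
have nufin k : nu [set k] \is a fin_num by rewrite fin_num_measure.
set g := fine \o 'd (charge_of_finite_measure r) '/d _.
set g' := fine \o 'd (charge_of_finite_measure r') '/d _.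
have {}pE k : p k = g k * (p k + q k) by rewrite -nuE; exact: pE.
have {}qE k : q k = g' k * (p k + q k) by rewrite -nuE; exact: qE.
have ratio k : p k + q k != 0 -> g k / g' k = p k / q k.
  by move=> w0; rewrite {1}pE {2}qE -mulf_div divff// mulr1.
case: ifPn => _; rewrite (integral_discrete nu)//.
- congr (_%:E); apply: eq_bigr => k _; rewrite nuE.
  (* At a label of mass zero the densities are arbitrary, but the term has weight 0 and [p k = 0] as
     well. *)
  have [w0|w0] := eqVneq (p k + q k) 0.
    by rewrite w0 mulr0 {1}pE w0 mulr0 mul0r.
  by rewrite ratio// mulrAC -pE.
- congr (_ * lne _%:E)%E; apply: eq_bigr => k _; rewrite nuE.
  have [w0|w0] := eqVneq (p k + q k) 0.
    by rewrite w0 mulr0 {1}qE w0 mulr0 mul0r.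
  by rewrite ratio// mulrAC -qE.
Qed.

End discrete.

(** * Smoothed classifiers *)

Section smoothed.
Context {R : realType} (n K : nat) (c : {mfun euclidean R n >-> 'I_K.+1}) (s : R).
Local Open Scope charge_scope.

(** The Gaussian at [x] has a density with respect to the one at [x'], and domination passes to
    images under [c]. This rules out the infinite branch of [renyi]. *)
Lemma smoothed_dominates (x x' : euclidean R n) :
  0 < s -> smoothed c s x `<< smoothed c s x'.
Proof.
move=> s0.
apply/null_content_dominatesP => A mA A0.
have mcA : measurable (c @^-1` A) by exact: measurable_funPTI.
rewrite /smoothed /= /distribution /pushforward (gaussian_prob_lr s n x x') ?gt_eqF//.
apply: null_set_integral => //.
by apply/measurable_EFinP/measurable_funTS; exact: measurable_gaussian_lr.
Qed.

(** The preimages of the labels partition the space, and the shifted Gaussian at the common centre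
    [z] gives them total mass 1. *)
Lemma smoothed_powR_sum_le (x x' : euclidean R n) (b : R) :
  0 < s -> 1 <= b ->
  \sum_k fine (smoothed c s x' [set k]) *
    (fine (smoothed c s x [set k]) / fine (smoothed c s x' [set k])) `^ b <=
  expR (b * (b - 1) * (l2_dist x x' ^+ 2 / (2 * s ^+ 2))).
Proof.
move=> s0 b1; have [z zP] := gaussian_prob_powR_le s n x x' b s0 b1.
have -> : b * (b - 1) * (l2_dist x x' ^+ 2 / (2 * s ^+ 2)) =
    b * (b - 1) * l2_dist x x' ^+ 2 / (2 * s ^+ 2) by rewrite mulrA.
rewrite -[leRHS]mulr1 -[X in _ <= _ * X](sum_probability_set1 K (smoothed c s z)) mulr_sumr.
apply: ler_sum => k _.
by apply: (zP (c @^-1` [set k])); exact: measurable_funPTI.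
Qed.

Lemma smoothed_renyi_le (x x' : euclidean R n) (b : R) :
  0 < s -> 1 <= b ->
  (renyi b (smoothed c s x) (smoothed c s x') <=
   (b * (l2_dist x x' ^+ 2 / (2 * s ^+ 2)))%:E)%E.
Proof.
move=> s0 b1; have dom := smoothed_dominates x x' s0.
rewrite (renyi_discrete K b _ _ dom); case: ifPn => [/eqP ->|bn1].
  rewrite lee_fin mul1r; apply: kl_le_of_powR_sum_le.
  - by move=> k; rewrite fine_ge0.
  - by move=> k; rewrite fine_ge0.
  - move=> k qk0; move/null_content_dominatesP : dom => -> //.
    by apply/eqP; rewrite -fine_eq0 ?fin_num_measure// qk0.
  - exact: sum_probability_set1.
  - by rewrite divr_ge0 ?sqr_ge0// mulr_ge0// sqr_ge0.
  - by move=> b' b'1; apply: smoothed_powR_sum_le => //; exact: ltW.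
have b_gt1 : 0 < b - 1 by rewrite subr_gt0 lt_neqAle eq_sym bn1.
rewrite lee_pdivrMl// -EFinM.
apply: (@le_trans _ _ (lne (expR (b * (b - 1) * (l2_dist x x' ^+ 2 / (2 * s ^+ 2))))%:E)).
  rewrite lee_lne ?in_itv/= ?leey ?andbT ?lee_fin ?expR_ge0//.
    exact: smoothed_powR_sum_le.
  by apply: sumr_ge0 => k _; rewrite mulr_ge0 ?powR_ge0 ?fine_ge0.
rewrite lne_EFin ?expR_gt0// expRK lee_fin.
by rewrite [leRHS]mulrCA [leRHS]mulrA.
Qed.

Lemma smoothed_tv_le (x x' : euclidean R n) : 0 < s ->
  (tv_distance (smoothed c s x) (smoothed c s x') <=
   (2 * std_normal_cdf (l2_dist x x' / (2 * s)) - 1)%:E)%E.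
Proof.
move=> s0; apply: ge_ereal_sup => _ [Z mZ <-].
have mcZ : measurable (c @^-1` Z) by exact: measurable_funPTI.
rewrite /smoothed /= /distribution /pushforward.
rewrite -(fineK (fin_num_measure (gaussian_prob s x) _ mcZ)).
rewrite -(fineK (fin_num_measure (gaussian_prob s x') _ mcZ)).
rewrite -EFinB abse_EFin lee_fin ler_norml; apply/andP; split.
  (* The lower bound is the upper bound with the two centres exchanged. *)
  rewrite lerNl opprB; have := gaussian_prob_sub_le s n x' x _ s0 mcZ.
  have -> // : l2_dist x' x = l2_dist x x'.
  by congr (Num.sqrt _); apply: eq_bigr => i _; rewrite -sqrrN opprB.
exact: gaussian_prob_sub_le.
Qed.

End smoothed.

Theorem theorem7 (R : realType) (n K : nat) (X : set (euclidean R n))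
    (hX : forall x, X x -> forall i, -1 <= (tnth x i : R) <= 1)
    (c : {mfun euclidean R n >-> 'I_K.+1}) (sigma : R) (hsigma : 0 < sigma)
    (alpha2 : R) (halpha2 : 0 < alpha2) :
  (forall beta : R, 1 <= beta ->
     robust X (smoothed c sigma) (renyi beta)
       alpha2 (alpha2 ^+ 2 * beta / (2 * sigma ^+ 2))) /\
  robust X (smoothed c sigma) (@tv_distance _ _ R)
    alpha2 (2 * std_normal_cdf (alpha2 / (2 * sigma)) - 1).
Proof.
split=> [beta beta1|] x x' _ _ xx'.
(* Both bounds, first obtained at the actual distance between [x] and [x'], increase with it. *)
- apply: le_trans (smoothed_renyi_le _ _ _ _ _ _ _ hsigma beta1) _.
  rewrite lee_fin [alpha2 ^+ 2 * beta]mulrC -[leRHS]mulrA.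
  apply: ler_wpM2l; first by lra.
  apply: ler_wpM2r; first by rewrite invr_ge0 mulr_ge0// sqr_ge0.
  by apply: lerXn2r; rewrite ?nnegrE ?sqrtr_ge0// ltW.
- apply: le_trans (smoothed_tv_le _ _ _ _ _ _ hsigma) _.
  rewrite lee_fin lerD2r ler_pM2l// std_normal_cdf_le//.
  by rewrite ler_wpM2r// invr_ge0 mulr_ge0// ltW.
Qed.
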